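(* Let $K$ be a perfect field, $V_1,\dots,V_d$ finite-dimensional $K$-vector spaces, $V=V_1\otimes\cdots\otimes V_d$ and $\alpha\in\mathbb{R}^d_{>0}$. For all tensors $v,w\in V$ we have $$\operatorname{rk}^G_\alpha(v+w)\le\operatorname{rk}^G_\alpha(v)+\operatorname{rk}^G_\alpha(w).$$
   Context: $G$-stable rank: for a $K$-vector space $W$ and $v(t)\in K((t))\otimes W$, $\operatorname{val}_t(v(t))$ is the largest integer $m$ with $v(t)\in t^m(K[[t]]\otimes W)$, and $\operatorname{val}_t(0)=\infty$. Let $\mathrm{GL}(V_i,K[[t]])$ be the set of elements of $K[[t]]\otimes\operatorname{End}(V_i)$ that are invertible over $K((t))$ (the inverse need not have entries in $K[[t]]$), and $G(K[[t]])=\prod_i\mathrm{GL}(V_i,K[[t]])$, acting on $K((t))\otimes V$ factorwise. Then $\operatorname{rk}^G_\alpha(v)$ is the infimum of $$\mu_\alpha(g(t),v)=\frac{\sum_{i=1}^d\alpha_i\operatorname{val}_t(\det g_i(t))}{\operatorname{val}_t(g(t)\cdot v)}$$ over all $g(t)=(g_1(t),\dots,g_d(t))\in G(K[[t]])$ with $\operatorname{val}_t(g(t)\cdot v)>0$ (a quotient with denominator $\infty$ is $0$). *)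

(* Defs.v *)
From HB Require Import structures.
From mathcomp Require Import all_boot all_order all_algebra all_field.
From mathcomp Require Import all_classical all_reals ereal.

Set Implicit Arguments.
Unset Strict Implicit.
Unset Printing Implicit Defensive.
Import Order.TTheory GRing.Theory Num.Theory passmx.
Local Open Scope classical_set_scope.
Local Open Scope ring_scope.

Definition perfect_field (K : fieldType) : Prop :=
  forall p : {poly K}, irreducible_poly p -> separable_poly p.

(* K[[t]] *)
Record fps (K : fieldType) := Fps { fcoef : nat -> K }.

HB.instance Definition _ (K : fieldType) := gen_eqMixin (fps K).
HB.instance Definition _ (K : fieldType) := gen_choiceMixin (fps K).

Section FpsRing.
Variable K : fieldType.
Implicit Types a b c : fps K.

Definition fps0 : fps K := Fps (fun=> 0).
Definition fps1 : fps K := Fps (fun n => (n == 0%N)%:R).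
Definition fps_opp a : fps K := Fps (fun n => - fcoef a n).
Definition fps_add a b : fps K := Fps (fun n => fcoef a n + fcoef b n).
Definition fps_mul a b : fps K :=
  Fps (fun n => \sum_(i < n.+1) fcoef a i * fcoef b (n - i)).

Lemma fpsP a b : fcoef a =1 fcoef b -> a = b.
Proof. by case: a b => [a] [b] /= /funext ->. Qed.

Fact fps_addA : associative fps_add.
Proof. by move=> a b c; apply: fpsP => n /=; rewrite addrA. Qed.
Fact fps_addC : commutative fps_add.
Proof. by move=> a b; apply: fpsP => n /=; rewrite addrC. Qed.
Fact fps_add0 : left_id fps0 fps_add.
Proof. by move=> a; apply: fpsP => n /=; rewrite add0r. Qed.
Fact fps_addN : left_inverse fps0 fps_opp fps_add.
Proof. by move=> a; apply: fpsP => n /=; rewrite addNr. Qed.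

HB.instance Definition _ :=
  GRing.isZmodule.Build (fps K) fps_addA fps_addC fps_add0 fps_addN.

Let trunc n a : {poly K} := \poly_(i < n) fcoef a i.

Let trunc_mul n m a b : (m < n)%N ->
  fcoef (fps_mul a b) m = (trunc n a * trunc n b)`_m.
Proof.
move=> mn; rewrite coefM /=; apply: eq_bigr => i _.
have im : (i <= m)%N by rewrite -ltnS.
by rewrite !coef_poly (leq_ltn_trans im mn) (leq_ltn_trans (leq_subr i m) mn).
Qed.

Let coef_mul_congr n (p q r : {poly K}) :
  (forall i, (i <= n)%N -> q`_i = r`_i) -> (p * q)`_n = (p * r)`_n.
Proof.
by move=> qr; rewrite !coefM; apply: eq_bigr => i _; rewrite qr // leq_subr.
Qed.

Fact fps_mulC : commutative fps_mul.
Proof.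
by move=> a b; apply: fpsP => n; rewrite !(@trunc_mul n.+1) // mulrC.
Qed.
Fact fps_mulA : associative fps_mul.
Proof.
move=> a b c; apply: fpsP => n.
rewrite [in RHS]fps_mulC !(@trunc_mul n.+1) //.
have E x y z : (trunc n.+1 x * trunc n.+1 (fps_mul y z))`_n =
    (trunc n.+1 x * (trunc n.+1 y * trunc n.+1 z))`_n.
  by apply: coef_mul_congr => i il; rewrite coef_poly ltnS il (@trunc_mul n.+1).
by rewrite !E; congr (_`_n); rewrite mulrA mulrC.
Qed.
Fact fps_mul1 : left_id fps1 fps_mul.
Proof.
move=> a; apply: fpsP => n /=.
by rewrite big_ord_recl /= mul1r subn0 big1 ?addr0 // => i _; rewrite mul0r.
Qed.
Fact fps_mulDl : left_distributive fps_mul fps_add.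
Proof.
move=> a b c; apply: fpsP => n /=.
by rewrite -big_split; apply: eq_bigr => i _; rewrite mulrDl.
Qed.
Fact fps1_neq0 : fps1 != 0.
Proof.
apply/eqP => /(congr1 (fun a => fcoef a 0)) /= /eqP.
by rewrite oner_eq0.
Qed.

HB.instance Definition _ := GRing.Zmodule_isComNzRing.Build (fps K)
  fps_mulA fps_mulC fps_mul1 fps_mulDl fps1_neq0.

Definition fps_unit : {pred fps K} := fun a => `[< exists b, b * a = 1 >].
Definition fps_inv a : fps K :=
  if pselect (exists b, b * a = 1) is left ab then projT1 (cid ab) else a.

Fact fps_mulV : {in fps_unit, left_inverse 1 fps_inv *%R}.
Proof.
move=> a /asboolP ua; rewrite /fps_inv.
by case: pselect => // ab; case: cid.
Qed.
Fact fps_unitP a b : b * a = 1 -> fps_unit a.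
Proof. by move=> ba; apply/asboolP; exists b. Qed.
Fact fps_inv_out : {in [predC fps_unit], fps_inv =1 id}.
Proof.
move=> a; rewrite inE /= => /asboolP ua; rewrite /fps_inv.
by case: pselect.
Qed.

HB.instance Definition _ := GRing.ComNzRing_hasMulInverse.Build (fps K)
  fps_mulV fps_unitP fps_inv_out.

Let fps_order a : a != 0 ->
  exists2 n, fcoef a n != 0 & forall m, (m < n)%N -> fcoef a m = 0.
Proof.
move=> a0; have exn : exists n, fcoef a n != 0.
  apply: contrapT => /forallNP a_0; move/eqP: a0; apply; apply: fpsP => n /=.
  by apply/eqP; have /negP := a_0 n; rewrite negbK.
case: (ex_minnP exn) => n an nmin; exists n => // m mn.
by apply/eqP; apply: contraTT mn => am; rewrite -leqNgt nmin.
Qed.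

Fact fps_integral : GRing.integral_domain_axiom (fps K).
Proof.
move=> a b ab0; apply/negP => /negP; rewrite negb_or => /andP[].
move=> /fps_order[n an na] /fps_order[m bm mb].
have := congr1 (fun c => fcoef c (n + m)) ab0; apply/eqP => /=.
have nm : (n < (n + m).+1)%N by rewrite ltnS leq_addr.
rewrite (bigD1 (Ordinal nm)) //= addKn big1 ?addr0 ?mulf_neq0 // => i ni.
have [lin|lni|e] := ltngtP i n; first by rewrite na ?mul0r.
  rewrite [fcoef b _]mb ?mulr0 // ltn_subLR ?ltn_add2r //.
  by rewrite -ltnS ltn_ord.
by case/eqP: ni; apply: val_inj.
Qed.

HB.instance Definition _ := GRing.ComUnitRing_isIntegral.Build (fps K)
  fps_integral.

Definition fpsC (c : K) : fps K := Fps (fun n => if n == 0%N then c else 0).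
Definition fpsX : fps K := Fps (fun n => (n == 1%N)%:R).

End FpsRing.
Arguments fps0 {K}.
Arguments fps1 {K}.
Arguments fpsX {K}.

(* K((t)) *)
Notation laurent K := {fraction (fps K)}.
Notation to_laurent := (@FracField.tofrac _).

Section Tensor.
Variables (K : fieldType) (d : nat) (V : 'I_d -> vectType K).

Local Notation basis i := (vbasis {:V i}).

(* Indices of the product basis of V_1 (x) ... (x) V_d. *)
Definition tidx := {dffun forall i : 'I_d, 'I_(\dim {:V i})}.

(* L (x)_K V_1 (x) ... (x) V_d in coordinates, for an extension L of K *)
Definition tensor_ext (L : Type) := {ffun tidx -> L}.

(* V_1 (x) ... (x) V_d in coordinates; the lemma tensor_univ is its universal
   property. *)
Definition tensor := tensor_ext K^o.
HB.instance Definition _ := Vector.copy tensor {ffun tidx -> K^o}.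

Definition pure_tensor (x : forall i, V i) : tensor :=
  [ffun j : tidx => \prod_i rVof (basis i) (x i) 0 (j i)].

Definition multilinear (U : lmodType K) (f : (forall i, V i) -> U) : Prop :=
  forall (x : forall i, V i) (i : 'I_d) (a : K) (y z : V i),
    f (dfwith x i (a *: y + z)) = a *: f (dfwith x i y) + f (dfwith x i z).

(* Factorwise action on L (x) V. As everywhere in MathComp, an endomorphism of
   V_i is represented by a matrix acting on row vectors from the right; the
   lemma tensor_act_pure identifies the action on pure tensors. *)
Definition tensor_act (L : comNzRingType) (g : forall i, 'M[L]_(\dim {:V i}))
    (x : tensor_ext L) : tensor_ext L :=
  [ffun j : tidx => \sum_(k : tidx) x k * \prod_i g i (k i) (j i)].

Let bvec (i : 'I_d) (k : 'I_(\dim {:V i})) : V i :=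
  vecof (basis i) (delta_mx 0 k).

Let rVof_bvec i k : rVof (basis i) (bvec k) = delta_mx 0 k.
Proof. exact/vecofK/vbasisP. Qed.

Let pure_bvec (j k : tidx) :
  pure_tensor (fun i => bvec (j i)) k = (k == j)%:R.
Proof.
rewrite ffunE; have [->|/eqP kj] := eqVneq k j.
  by rewrite big1 // => i _; rewrite rVof_bvec mxE !eqxx.
have [i ki] : exists i, k i != j i.
  apply/existsP; apply: contra_notT kj => /existsPn kj; apply/ffunP => i.
  by apply/eqP; rewrite -[_ == _]negbK kj.
by rewrite (bigD1 i) //= rVof_bvec mxE eqxx (negPf ki) mul0r.
Qed.

Fact pure_multilinear : multilinear pure_tensor.
Proof.
move=> x i a y z; apply/ffunP => j; rewrite !ffunE.
have prodE u : \prod_k rVof (basis k) (dfwith x i u k) 0 (j k) =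
    rVof (basis i) u 0 (j i) * \prod_(k | k != i) rVof (basis k) (x k) 0 (j k).
  rewrite (bigD1 i) //= dfwithin; congr (_ * _).
  by apply: eq_bigr => k ki; rewrite dfwithout // eq_sym.
rewrite !prodE linearP [X in X * _ = _]mxE [X in (X + _) * _]mxE.
by rewrite mulrDl -mulrA.
Qed.

Let multilinear_sum (U : lmodType K) (f : (forall i, V i) -> U) x i
    (I : finType) (c : I -> K) (y : I -> V i) : multilinear f ->
  f (dfwith x i (\sum_k c k *: y k)) = \sum_k c k *: f (dfwith x i (y k)).
Proof.
move=> fP; have f0 : f (dfwith x i (0 : V i)) = 0.
  by have := fP x i (-1) 0 0; rewrite scaler0 addr0 scaleN1r addNr.
elim/big_rec2: _ => // k u v _ <-; exact: fP.
Qed.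

Let multilinear_eq0 (U : lmodType K) (f : (forall i, V i) -> U) :
  multilinear f -> (forall j : tidx, f (fun i => bvec (j i)) = 0) ->
  forall x, f x = 0.
Proof.
move=> fP fb x.
have fs (s : seq 'I_d) : forall y : forall i, V i,
    (forall i, i \notin s -> exists k, y i = bvec k) -> f y = 0.
  elim: s => [|i s IH] y yP.
    have yi i : exists k, y i = bvec k by exact: yP.
    pose j : tidx := [ffun i => projT1 (cid (yi i))].
    rewrite -(fb j); congr f; apply: functional_extensionality_dep => i.
    by rewrite ffunE; case: cid.
  have -> : y = dfwith y i (y i).
    by apply: functional_extensionality_dep => k; case: dfwithP.
  have -> : y i = \sum_k (rVof (basis i) (y i) 0 k) *: bvec k.
    rewrite -[LHS](rVofK (vbasisP _)) [in LHS](row_sum_delta (rVof _ _)).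
    by rewrite linear_sum; apply: eq_bigr => k _; rewrite linearZ.
  rewrite multilinear_sum // big1 // => k _; rewrite IH ?scaler0 // => l ls.
  have [<-|il] := eqVneq i l; first by exists k; rewrite dfwithin.
  by rewrite dfwithout //; apply: yP; rewrite inE negb_or eq_sym il.
by apply: (fs (enum 'I_d)) => i; rewrite mem_enum.
Qed.

Lemma tensor_univ (U : lmodType K) (f : (forall i, V i) -> U) :
  multilinear f ->
  exists F : {linear tensor -> U}, (forall x, F (pure_tensor x) = f x) /\
    forall F' : {linear tensor -> U},
      (forall x, F' (pure_tensor x) = f x) -> F' =1 F.
Proof.
move=> fP.
pose F (t : tensor) : U := \sum_(j : tidx) (t j : K) *: f (fun i => bvec (j i)).
have F_lin : linear F.
  move=> a u v; rewrite /F scaler_sumr -big_split; apply: eq_bigr => j _ /=.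
  by rewrite !ffunE scalerDl scalerA.
pose lF : {linear tensor -> U} :=
  HB.pack F (GRing.isLinear.Build _ _ _ _ F F_lin).
have lFE x : lF (pure_tensor x) = f x.
  apply/eqP; rewrite -subr_eq0; apply/eqP; move: x.
  apply: (@multilinear_eq0 _ (fun x => lF (pure_tensor x) - f x)).
    move=> x i a y z; rewrite pure_multilinear fP linearP scalerBr.
    by rewrite opprD addrACA.
  move=> j; apply/eqP; rewrite subr_eq0 /= /F (bigD1 j) //=.
  rewrite pure_bvec eqxx scale1r big1 ?addr0 // => k kj.
  by rewrite pure_bvec (negPf kj) scale0r.
exists lF; split => // F' F'E t.
have -> : t = \sum_(j : tidx) (t j : K) *: pure_tensor (fun i => bvec (j i)).
  apply/ffunP => k; rewrite sum_ffunE (bigD1 k) //= big1 ?addr0.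
    by rewrite ffunE pure_bvec eqxx /GRing.scale /= mulr1.
  move=> j jk; rewrite ffunE pure_bvec eq_sym (negPf jk).
  by rewrite /GRing.scale /= mulr0.
by rewrite !linear_sum; apply: eq_bigr => j _; rewrite !linearZ F'E lFE.
Qed.

Lemma tensor_act_pure (phi : forall i, 'End(V i)) (x : forall i, V i) :
  tensor_act (fun i => mxof (basis i) (basis i) (phi i)) (pure_tensor x) =
  pure_tensor (fun i => phi i (x i)).
Proof.
set g := fun i => _; apply/eqP; rewrite -subr_eq0; apply/eqP; move: x.
pose f x : tensor :=
  (tensor_act g (pure_tensor x) : tensor) - pure_tensor (fun i => phi i (x i)).
apply: (@multilinear_eq0 _ f) => [x i a y z|j]; rewrite /f.
  have phiE u : (fun k => phi k (dfwith x i u k)) =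
      dfwith (fun k => phi k (x k)) i (phi i u).
    apply: functional_extensionality_dep => k.
    by case: dfwithP => [|k' ik]; rewrite ?dfwithin ?dfwithout.
  rewrite !phiE linearP !pure_multilinear scalerBr addrACA -opprD.
  congr (_ - _); apply/ffunP => j; rewrite !ffunE scaler_sumr -big_split.
  by apply: eq_bigr => k _; rewrite !ffunE mulrDl -[in LHS]mulrA.
apply/eqP; rewrite subr_eq0; apply/eqP/ffunP => k.
rewrite [LHS]ffunE [RHS]ffunE.
rewrite (bigD1 j) //= [X in _ + X]big1 ?addr0 => [|l lj]; last first.
  by rewrite pure_bvec (negPf lj) mul0r.
rewrite pure_bvec eqxx mul1r; apply: eq_bigr => i _.
by rewrite (rVof_app _ (vbasisP _)) rVof_bvec -rowE [RHS]mxE.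
Qed.

End Tensor.

Section GStableRank.
Variables (R : realType) (K : fieldType).

(* x in t^m (K[[t]] (x) W), for x in K((t)) (x) W, in coordinates with respect
   to a basis of W indexed by I *)
Definition in_lattice (I : finType) (m : int) (x : {ffun I -> laurent K}) :=
  exists y : {ffun I -> fps K},
    x = [ffun i => (to_laurent fpsX) ^ m * to_laurent (y i)].

(* As a supremum in the extended reals, this is the largest such m if x != 0,
   and +oo if x = 0. *)
Definition valt (I : finType) (x : {ffun I -> laurent K}) : \bar R :=
  ereal_sup [set (m%:~R)%:E | m in [set m : int | in_lattice m x]].

Lemma valt_max (I : finType) (x : {ffun I -> laurent K}) (m : int) :
  in_lattice m x -> (forall n, in_lattice n x -> n <= m) ->
  valt x = (m%:~R)%:E.
Proof.
move=> xm m_max; apply/eqP; rewrite eq_le; apply/andP; split.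
  by apply: ge_ereal_sup => _ [n xn <-]; rewrite lee_fin ler_int m_max.
by apply: ereal_sup_ubound; exists m.
Qed.

Lemma valt0 (I : finType) : valt (0 : {ffun I -> laurent K}) = +oo%E.
Proof.
apply/eqyP => r _; set m := Num.ceil r.
apply: (@le_trans _ _ (m%:~R)%:E); first by rewrite lee_fin ceil_ge.
apply: ereal_sup_ubound; exists m => //; exists 0.
by apply/ffunP => i; rewrite !ffunE rmorph0 mulr0.
Qed.

(* W = K *)
Definition valt_scalar (a : laurent K) : \bar R := valt [ffun _ : unit => a].

Variables (d : nat) (V : 'I_d -> vectType K).

(* GL(W, K[[t]]) for dim W = n: invertibility is over K((t)). *)
Definition GL_fps (n : nat) : set 'M[fps K]_n :=
  [set g | map_mx to_laurent g \in unitmx].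

Definition tensor_laurent (v : tensor V) : tensor_ext V (laurent K) :=
  [ffun j => to_laurent (fpsC (v j : K))].

Definition fps_act (g : forall i, 'M[fps K]_(\dim {:V i})) (v : tensor V) :=
  tensor_act (fun i => map_mx to_laurent (g i)) (tensor_laurent v).

(* For the division of extended reals, x / +oo = 0 for every real x. *)
Definition mu_alpha (alpha : 'I_d -> R) (g : forall i, 'M[fps K]_(\dim {:V i}))
    (v : tensor V) : \bar R :=
  ((\sum_(i < d) (alpha i)%:E * valt_scalar (to_laurent (\det (g i))))
   / valt (fps_act g v))%E.

Definition rkG (alpha : 'I_d -> R) (v : tensor V) : \bar R :=
  ereal_inf [set mu_alpha alpha g v | g in
    [set g : forall i, 'M[fps K]_(\dim {:V i}) |
      (forall i, GL_fps (g i)) /\ (0%E < valt (fps_act g v))%E]].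

End GStableRank.

(* Main.v *)
Require Import Defs.
From HB Require Import structures.
From mathcomp Require Import all_boot all_order all_algebra all_field.
From mathcomp Require Import perm.
From mathcomp Require Import all_classical all_reals ereal.

Set Implicit Arguments.
Unset Strict Implicit.
Unset Printing Implicit Defensive.
Import Order.TTheory GRing.Theory Num.Theory.
Local Open Scope ring_scope.

(** Write O = K[[t]]. An element g of GL(V_i, O) matters only through the
    lattice L(g) of all x in K((t)) (x) V_i with g x in O (x) V_i: the valuation
    of det g is the length of L(g) / (O (x) V_i), and val_t(g v) >= m means that
    v lies in t^m times the tensor product of the lattices L(g_i).

    If v = 0 or w = 0, the claim follows from the ranks being nonnegative.
    Otherwise let g and h be admissible for v and w, with val_t(g v) = m and
    val_t(h w) = n, which are finite. The coefficients of v and w do not involve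
    t, so the substitution t -> t^n in g multiplies both the valuations of the
    determinants and val_t(g v) by n, and leaves mu_alpha(g, v) unchanged. After
    it, and after t -> t^m in h, both valuations of the transformed tensors are
    m n. Now replace each pair (g_i, h_i) by an element c_i with lattice L(g_i)
    + L(h_i). This lattice contains both, so t^(mn) divides c (v + w); its
    length over O (x) V_i is at most the sum of the two lengths. Dividing the
    weighted sum of these lengths by m n gives mu_alpha(c, v + w) <= mu_alpha(g,
    v) + mu_alpha(h, w), and the infimum over g and h is the theorem.

    In terms of matrices acting on row vectors from the right, c_i is a common
    right multiple A P = B Q of A = g_i and B = h_i whose determinant divides
    det A * det B ([common_right_multiple]). It comes from column reduction of
    the block row [A | B] over the valuation ring O. The three other ingredients
    are that t -> t^k is a ring endomorphism of O ([fps_subst]), that the action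
    on tensors is functorial ([tensor_act_mul], [tensor_act_map]), and that
    val_t of an integral tensor is the least order of its coordinates
    ([valt_fps]). *)

(** * Column reduction over a valuation ring *)

Section ValuationRing.
Variable R : comUnitRingType.

Definition dvd_total :=
  forall a b : R, (exists c, b = a * c) \/ (exists c, a = b * c).

Hypothesis RP : dvd_total.

Lemma exists_common_divisor n (r : 'I_n.+1 -> R) :
  exists j0, forall j, exists c, r j = r j0 * c.
Proof.
elim: n r => [|n IH] r.
  by exists 0 => j; exists 1; rewrite mulr1 (ord1 j).
have [j1 j1P] := IH (fun j => r (lift ord0 j)).
have [[c cP]|[c cP]] := RP (r ord0) (r (lift ord0 j1)).
  exists ord0 => j; case: (unliftP ord0 j) => [k ->|->].
    by have [e ->] := j1P k; exists (c * e); rewrite cP mulrA.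
  by exists 1; rewrite mulr1.
exists (lift ord0 j1) => j; case: (unliftP ord0 j) => [k ->|->].
  exact: j1P.
by exists c.
Qed.

(** Move an entry dividing all others to the first position and subtract
    multiples of its column from the other columns. *)
Lemma row_reduction m (r : 'rV[R]_(1 + m)) :
  exists2 E, \det E \is a GRing.unit & rsubmx (r *m E) = 0.
Proof.
have [j0 j0P] := exists_common_divisor (fun j => r 0 j).
pose s : 'rV_(1 + m) := r *m tperm_mx 0 j0.
have [c cP] : exists c, rsubmx s = lsubmx s *m c.
  have sP j : exists c, rsubmx s 0 j = s 0 0 * c.
    rewrite mxE /s -xcolE !mxE tpermL; exact: j0P.
  exists (\row_j projT1 (cid (sP j))); apply/rowP => j.
  rewrite [RHS]mxE big_ord1 [lsubmx _ _ _]mxE [X in _ * X]mxE lshift0.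
  by case: cid => e /= <-.
pose B : 'M[R]_(1 + m) := block_mx 1%:M (- c) 0 1%:M.
exists (tperm_mx 0 j0 *m B).
  rewrite det_mulmx /B det_ublock !det1 !mulr1 det_perm.
  by rewrite unitrX // unitrN1.
have -> : r *m (tperm_mx 0 j0 *m B) = s *m B by rewrite mulmxA.
rewrite -[s]hsubmxK mul_row_block row_mxKr.
by rewrite mulmx1 mulmxN -cP addNr.
Qed.

(** Clear the first row with [row_reduction], then recurse on the lower right
    block. *)
Lemma column_reduction n m (M : 'M[R]_(n, m)) :
  exists2 E, \det E \is a GRing.unit & is_trig_mx (M *m E).
Proof.
elim: n m M => [|n IH] [|m] M.
- by exists 1%:M; [rewrite det1 unitr1 | apply/is_trig_mxP => -[]].
- by exists 1%:M; [rewrite det1 unitr1 | apply/is_trig_mxP => -[]].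
- by exists 1%:M; [rewrite det1 unitr1 | apply/is_trig_mxP => i []].
rewrite -[n.+1]/(1 + n)%N -[m.+1]/(1 + m)%N in M *.
have [E1 E1u E1P] := row_reduction (usubmx M).
have [E2 E2u E2P] := IH m (drsubmx (M *m E1)).
exists (E1 *m block_mx 1%:M 0 0 E2).
  by rewrite det_mulmx det_ublock det1 mul1r unitrM E1u.
rewrite mulmxA -[M *m E1]submxK.
have -> : ursubmx (M *m E1) = 0.
  by rewrite -E1P -[in LHS](vsubmxK M) mul_col_mx /ursubmx col_mxKu.
rewrite mulmx_block !mul0mx !mulmx0 !addr0 !add0r mulmx1 is_trig_block_mx //=.
by rewrite eqxx E2P andbT; apply/is_trig_mxP => i j; rewrite !ord1.
Qed.

(** Column reduction provides an invertible E with [A | B] E = [H | 0]. The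
    right half of E is a syzygy A E12 + B E22 = 0, so C = B E22 is a common
    right multiple. Taking determinants in
      [A B; 0 1] E = [H 0; E21 E22]
    gives det A * det E = det H * det E22, which bounds det E22 and hence
    det C. The factor h below is det H, and the unit u is det E. *)
Lemma common_right_multiple n (A B : 'M[R]_n) :
  exists P Q : 'M[R]_n, A *m P = B *m Q /\
  exists h u, u \is a GRing.unit /\ \det (A *m P) * h = \det A * \det B * u.
Proof.
have [E Eu Etrig] := column_reduction (row_mx A B).
have hE : row_mx A B *m E =
    row_mx (A *m ulsubmx E + B *m dlsubmx E) (A *m ursubmx E + B *m drsubmx E).
  by rewrite -[in LHS](submxK E) mul_row_block.
set H := A *m ulsubmx E + _ in hE.
have E0 : A *m ursubmx E + B *m drsubmx E = 0.
  apply/matrixP => i j; have /is_trig_mxP/(_ i (rshift n j)) := Etrig.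
  by rewrite hE row_mxEr => ->; [rewrite mxE | rewrite /= ltn_addr].
have AB : A *m - ursubmx E = B *m drsubmx E.
  by rewrite mulmxN; apply/eqP; rewrite eq_sym -addr_eq0 addrC E0.
exists (- ursubmx E), (drsubmx E); split=> //; exists (\det H), (\det E).
split=> //; rewrite AB det_mulmx.
have : block_mx A B 0 1%:M *m E = block_mx H 0 (dlsubmx E) (drsubmx E).
  by rewrite -[in LHS](submxK E) mulmx_block !mul0mx !mul1mx !add0r E0.
move/(congr1 determinant); rewrite det_mulmx det_ublock det_lblock det1 mulr1.
by move=> e; rewrite mulrAC -mulrA -e mulrCA mulrA.
Qed.

End ValuationRing.

(** * The factorwise action on tensors *)

Section TensorAction.
Variables (K : fieldType) (d : nat) (V : 'I_d -> vectType K).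

(** Distributivity of a product over sums whose index sets depend on the factor:
    this is what makes the action on tensors functorial. *)
Lemma prod_sum_dffun (L : comNzRingType) (n : 'I_d -> nat)
    (F : forall i, 'I_(n i) -> L) :
  \prod_i \sum_l F i l =
  \sum_(f : {dffun forall i, 'I_(n i)}) \prod_i F i (f i).
Proof.
under eq_bigr do rewrite (big_tag F).
rewrite (bigA_distr_big_dep _ (fun i j => untag 0 (F i) j)).
rewrite [RHS](reindex _ (onW_bij _ (dffun_of_fprod_bij _))) /=.
pose P i : {ffun 'I_(n i) -> L} := [ffun l => F i l].
transitivity (\sum_(t : fprod (fun i => 'I_(n i) : finType))
    \prod_(i in 'I_d) P i (t i)).
  rewrite big_fprod; apply: eq_bigr => g _; apply: eq_bigr => i _.
  by rewrite /untag; case: eqP => // e; rewrite ffunE.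
by apply: eq_bigr => t _; apply: eq_bigr => i _; rewrite !ffunE.
Qed.

Variable L : comNzRingType.
Implicit Types (g h : forall i, 'M[L]_(\dim {:V i})) (x y : tensor_ext V L).

Lemma tensor_act_mul g h x :
  tensor_act (fun i => g i *m h i) x = tensor_act h (tensor_act g x).
Proof.
apply/ffunP => j; rewrite !ffunE.
under [RHS]eq_bigr do rewrite ffunE mulr_suml.
rewrite exchange_big; apply: eq_bigr => k _ /=.
under eq_bigr do rewrite mxE.
rewrite prod_sum_dffun mulr_sumr; apply: eq_bigr => l _.
by rewrite big_split mulrA.
Qed.

Lemma tensor_act_scalar (a : 'I_d -> L) x j :
  tensor_act (fun i => (a i)%:M) x j = x j * \prod_i a i.
Proof.
rewrite ffunE (bigD1 j) //= [X in _ + X]big1 ?addr0 => [|k kj].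
  by congr (_ * _); apply: eq_bigr => i _; rewrite mxE eqxx.
have [i /negPf ki] : exists i, k i != j i.
  apply/existsP; apply: contraNT kj => /existsPn kj; apply/eqP/ffunP => i.
  by apply/eqP; rewrite -[_ == _]negbK kj.
by rewrite (bigD1 i) //= mxE ki mul0r mulr0.
Qed.

Lemma tensor_act_map (L' : comNzRingType) (f : {rmorphism L -> L'}) g x :
  tensor_act (fun i => map_mx f (g i)) [ffun j => f (x j)] =
  [ffun j => f (tensor_act g x j)].
Proof.
apply/ffunP => j; rewrite !ffunE rmorph_sum; apply: eq_bigr => k _.
rewrite ffunE rmorphM rmorph_prod; congr (_ * _).
by apply: eq_bigr => i _; rewrite mxE.
Qed.

Lemma tensor_act_dvd (a : L) g x :
  (forall j, exists b, x j = a * b) ->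
  forall j, exists b, tensor_act g x j = a * b.
Proof.
move=> xP j; exists (\sum_k projT1 (cid (xP k)) * \prod_i g i (k i) (j i)).
rewrite ffunE mulr_sumr; apply: eq_bigr => k _; case: cid => b /= ->.
by rewrite mulrA.
Qed.

Lemma tensor_actD g x y j :
  tensor_act g [ffun k => x k + y k] j = tensor_act g x j + tensor_act g y j.
Proof.
by rewrite !ffunE -big_split; apply: eq_bigr => k _; rewrite ffunE mulrDl.
Qed.

End TensorAction.

(** Acting by g and then by the adjugates of the g_i multiplies x by the product
    of the det g_i. *)
Lemma tensor_act_neq0 (K : fieldType) d (V : 'I_d -> vectType K)
    (L : idomainType) (g : forall i, 'M[L]_(\dim {:V i}))
    (x : tensor_ext V L) j :
  (forall i, \det (g i) != 0) -> x j != 0 -> exists k, tensor_act g x k != 0.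
Proof.
move=> gu xj; apply/existsP; apply: contraNT xj => /existsPn gx0.
have : tensor_act (fun i => \adj (g i)) (tensor_act g x) j = 0.
  by rewrite ffunE big1 // => k _; have /negPn/eqP -> := gx0 k; rewrite mul0r.
rewrite -tensor_act_mul.
have -> : (fun i => g i *m \adj (g i)) = (fun i => (\det (g i))%:M).
  by apply: functional_extensionality_dep => i; rewrite mul_mx_adj.
rewrite tensor_act_scalar => /eqP; rewrite mulf_eq0 => /orP[//|].
by rewrite prodf_seq_eq0 => /hasP[i _]; rewrite (negPf (gu i)).
Qed.

(** * Order and substitution in K[[t]] *)

Section PowerSeries.
Variable K : fieldType.
Implicit Types a b u : fps K.

Lemma fcoef_sum (I : Type) (r : seq I) (F : I -> fps K) n :
  fcoef (\sum_(i <- r) F i) n = \sum_(i <- r) fcoef (F i) n.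
Proof. by elim/big_ind2: _ => // a x b y <- <-. Qed.

Lemma fcoef_mulX a n :
  fcoef (fpsX * a) n = if n is n'.+1 then fcoef a n' else 0.
Proof.
case: n => [|n] /=; first by rewrite big_ord1 mul0r.
rewrite big_ord_recl mul0r add0r big_ord_recl /= mul1r subSS subn0.
by rewrite big1 ?addr0 // => i _; rewrite mul0r.
Qed.

Lemma fcoef_mulXn n a m :
  fcoef (fpsX ^+ n * a) m = if (m < n)%N then 0 else fcoef a (m - n).
Proof.
elim: n m => [|n IH] m; first by rewrite expr0 mul1r subn0.
by rewrite exprS -mulrA fcoef_mulX; case: m => // m; rewrite IH ltnS subSS.
Qed.

Lemma dvd_fpsXnP n a :
  (exists b, a = fpsX ^+ n * b) <-> (forall m, (m < n)%N -> fcoef a m = 0).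
Proof.
split=> [[b ->] m mn|a0]; first by rewrite fcoef_mulXn mn.
exists (Fps (fun m => fcoef a (m + n))); apply: fpsP => m.
by rewrite fcoef_mulXn; case: ltnP => [/a0 //|nm] /=; rewrite subnK.
Qed.

(** If y = 1 - u / u(0), then u / u(0) = 1 - y is inverted by the geometric
    series in y, which makes sense because t divides y. *)
Lemma fps_unitE u : (u \is a GRing.unit) = (fcoef u 0 != 0).
Proof.
apply/idP/idP => [/mulVr/(congr1 (fun c => fcoef c 0)) /=|u0].
  rewrite big_ord1 => e; apply/eqP => u0; move/eqP: e.
  by rewrite u0 mulr0 eq_sym oner_eq0.
pose y := 1 - fpsC (fcoef u 0)^-1 * u.
have [b yE] : exists b, y = fpsX ^+ 1 * b.
  by apply/dvd_fpsXnP => -[|//] _ /=; rewrite big_ord1 mulVf ?subrr.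
pose S n := \sum_(i < n) y ^+ i.
pose s : fps K := Fps (fun n => fcoef (S n.+1) n).
(* t^i divides y^i, so the terms of degree i > m do not affect coefficient m. *)
have sE n m : (m < n)%N -> fcoef s m = fcoef (S n) m.
  move=> mn; rewrite /= !fcoef_sum.
  rewrite (big_ord_widen n (fun i => fcoef (y ^+ i) m)) //.
  rewrite big_mkcond; apply: eq_bigr => i _; case: ifP => // im.
  by rewrite yE exprMn expr1 fcoef_mulXn ltnNge -ltnS im.
apply/unitrP; exists (fpsC (fcoef u 0)^-1 * s).
suff e : fpsC (fcoef u 0)^-1 * u * s = 1.
  by rewrite mulrAC e [u * _]mulrCA mulrA e.
have -> : fpsC (fcoef u 0)^-1 * u = 1 - y by rewrite subKr.
apply: fpsP => n; transitivity (fcoef ((1 - y) * S n.+1) n).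
  by apply: eq_bigr => i _; rewrite (sE n.+1) // ltnS leq_subr.
have -> : (1 - y) * S n.+1 = 1 - y ^+ n.+1.
  by rewrite -[LHS]opprK -mulNr opprB -subrX1 opprB.
rewrite yE exprMn expr1 -[LHS]/(_ - fcoef (fpsX ^+ n.+1 * _) n).
by rewrite fcoef_mulXn ltnSn subr0.
Qed.

(** The t-adic valuation, with the junk value 0 at the zero series. *)
Definition fps_ord a : nat :=
  if pselect (exists n, fcoef a n != 0) is left e then ex_minn e else 0.

Lemma fps_ordP a : a != 0 ->
  exists2 u, fcoef u 0 != 0 & a = fpsX ^+ fps_ord a * u.
Proof.
move=> a0; rewrite /fps_ord; case: pselect => [e|]; last first.
  move=> /forallNP a_0; case/eqP: a0; apply: fpsP => n /=.
  by apply/eqP; have /negP := a_0 n; rewrite negbK.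
case: ex_minnP => n an nmin.
have /dvd_fpsXnP[u au] : forall m, (m < n)%N -> fcoef a m = 0.
  by move=> m mn; apply/eqP; apply: contraTT mn => am; rewrite -leqNgt nmin.
by exists u => //; move: an; rewrite au fcoef_mulXn ltnn subnn.
Qed.

Lemma fpsXn_neq0 n : fpsX ^+ n != 0 :> fps K.
Proof.
rewrite expf_neq0 //; apply/eqP => /(congr1 (fun a => fcoef a 1)) /eqP /=.
by rewrite oner_eq0.
Qed.

Lemma fps_ord_max n a : a != 0 -> (exists b, a = fpsX ^+ n * b) ->
  (n <= fps_ord a)%N.
Proof.
move=> /fps_ordP[u u0 aE] /dvd_fpsXnP/(_ (fps_ord a)) an.
rewrite leqNgt; apply/negP => /an /eqP; rewrite {1}aE fcoef_mulXn ltnn subnn.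
exact/negP.
Qed.

Lemma fps_ord_eq n u : fcoef u 0 != 0 -> fps_ord (fpsX ^+ n * u) = n.
Proof.
move=> u0; set a := _ * u.
have an : fcoef a n != 0 by rewrite fcoef_mulXn ltnn subnn.
have a0 : a != 0 by apply: contraNneq an => ->.
apply/eqP; rewrite eqn_leq (@fps_ord_max n a) ?andbT //; last by exists u.
have [w w0 aE] := fps_ordP a0; move: an; rewrite leqNgt; apply: contraNN => na.
by rewrite aE fcoef_mulXn na.
Qed.

Lemma fps_ordM a b : a != 0 -> b != 0 ->
  fps_ord (a * b) = (fps_ord a + fps_ord b)%N.
Proof.
move=> /fps_ordP[u u0 aE] /fps_ordP[w w0 bE].
rewrite {1}aE {1}bE mulrACA -exprD fps_ord_eq //=.
by rewrite big_ord1 mulf_neq0.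
Qed.

Lemma fps_ord_unit u : u \is a GRing.unit -> fps_ord u = 0%N.
Proof. by rewrite fps_unitE => /(fps_ord_eq 0); rewrite expr0 mul1r. Qed.

Lemma fps_dvd_total : dvd_total (fps K).
Proof.
have dvd a b : b != 0 -> (a == 0) || (fps_ord b <= fps_ord a)%N ->
    exists c, a = b * c.
  move=> /fps_ordP[u u0 bE] /orP[/eqP->|]; first by exists 0; rewrite mulr0.
  have [->|/fps_ordP[w w0 aE] ba] := eqVneq a 0.
    by exists 0; rewrite mulr0.
  exists (fpsX ^+ (fps_ord a - fps_ord b) * (u^-1 * w)).
  rewrite {1}bE mulrACA -exprD subnKC // mulVKr ?fps_unitE //.
move=> a b; have [->|a0] := eqVneq a 0; first by right; exists 0; rewrite mulr0.
have [->|b0] := eqVneq b 0; first by left; exists 0; rewrite mulr0.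
have [ab|ba] := leqP (fps_ord a) (fps_ord b).
  by left; apply: dvd => //; rewrite ab orbT.
by right; apply: dvd => //; rewrite (ltnW ba) orbT.
Qed.

(** The substitution t -> t^(k+1); the shift keeps the exponent positive, so
    that this is a ring morphism for every k. *)
Definition fps_subst k a : fps K :=
  Fps (fun n => if (k.+1 %| n)%N then fcoef a (n %/ k.+1) else 0).

Lemma fps_subst_zmod k : zmod_morphism (fps_subst k).
Proof.
by move=> a b; apply: fpsP => n /=; case: ifP => // _; rewrite subr0.
Qed.

(** The coefficients of degree at most n of a product depend only on those of
    the factors, so multiplicativity follows from that of the composition of
    polynomials with 'X^(k+1). *)
Lemma fps_subst_monoid k : monoid_morphism (fps_subst k).
Proof.
split=> [|a b]; apply: fpsP => n /=.
  case: ifP => [/dvdnP[m ->]|]; first by rewrite mulnK // muln_eq0 orbF.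
  by case: n.
pose p c : {poly K} := \poly_(i < n.+1) fcoef c i.
transitivity (((p a * p b) \Po 'X^(k.+1))`_n).
  rewrite coef_comp_poly_Xn //; case: ifP => // _; rewrite coefM.
  apply: eq_bigr => i _; have il : (i <= n)%N.
    by rewrite (leq_trans _ (leq_div n k.+1)) // -ltnS.
  by rewrite !coef_poly !ltnS il (leq_trans (leq_subr _ _) (leq_div _ _)).
rewrite comp_polyM coefM; apply: eq_bigr => i _.
have cE c m : (m <= n)%N -> (p c \Po 'X^(k.+1))`_m = fcoef (fps_subst k c) m.
  move=> mn; rewrite coef_comp_poly_Xn //= coef_poly ltnS.
  by rewrite (leq_trans (leq_div _ _) mn).
by rewrite !cE ?leq_subr // -ltnS.
Qed.

HB.instance Definition _ k :=
  GRing.isZmodMorphism.Build (fps K) (fps K) (fps_subst k) (fps_subst_zmod k).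
HB.instance Definition _ k :=
  GRing.isMonoidMorphism.Build (fps K) (fps K) (fps_subst k)
    (fps_subst_monoid k).

Lemma fps_substC k c : fps_subst k (fpsC c) = fpsC c.
Proof.
apply: fpsP => n /=; case: ifP => [/dvdnP[m ->]|].
  by rewrite mulnK // muln_eq0 orbF.
by case: n.
Qed.

Lemma fps_substX k : fps_subst k fpsX = fpsX ^+ k.+1.
Proof.
apply: fpsP => n; rewrite -[fpsX ^+ _]mulr1 fcoef_mulXn /=.
case: ifP => [/dvdnP[m ->]|kn].
  rewrite mulnK //; case: m => [|m]; first by rewrite mul0n.
  rewrite mulSn ltnNge leq_addr /= addKn muln_eq0 orbF.
  by case: m.
case: ltnP => // nk; have -> : (n - k.+1 == 0)%N = false => //.
apply: contraFF kn; rewrite subn_eq0 => nk'.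
by rewrite (@anti_leq n k.+1) ?nk' ?nk.
Qed.

Lemma fps_ord_subst k a : a != 0 ->
  fps_ord (fps_subst k a) = (k.+1 * fps_ord a)%N.
Proof.
move=> /fps_ordP[u u0 aE]; rewrite {1}aE rmorphM rmorphXn /= fps_substX.
by rewrite -exprM fps_ord_eq.
Qed.

Lemma fps_subst_dvd k n a : (exists b, a = fpsX ^+ n * b) ->
  exists b, fps_subst k a = fpsX ^+ (k.+1 * n) * b.
Proof.
case=> b ->; exists (fps_subst k b).
by rewrite rmorphM rmorphXn /= fps_substX -exprM.
Qed.

Lemma fps_subst_neq0 k a : a != 0 -> fps_subst k a != 0.
Proof.
move=> a0; have [u u0 ->] := fps_ordP a0.
rewrite rmorphM rmorphXn /= fps_substX -exprM mulf_neq0 ?fpsXn_neq0 //.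
by apply: contraNneq u0 => /(congr1 (fun c => fcoef c 0)) /= ->.
Qed.

End PowerSeries.

(** * Valuations of integral vectors *)

Section Valuation.
Variables (R : realType) (K : fieldType).

Lemma in_lattice_fpsP (I : finType) (y : {ffun I -> fps K}) (n : nat) :
  in_lattice n [ffun i => to_laurent (y i)] <->
  (forall i, exists b, y i = fpsX ^+ n * b).
Proof.
split=> [[z zE] i|yP].
  exists (z i); have /ffunP/(_ i) := zE; rewrite !ffunE.
  by rewrite -exprnP -rmorphXn -rmorphM => /eqP; rewrite tofrac_eq => /eqP.
exists [ffun i => projT1 (cid (yP i))]; apply/ffunP => i; rewrite !ffunE.
by case: cid => b /= ->; rewrite rmorphM rmorphXn -exprnP.
Qed.

Lemma valt_ge (I : finType) (y : {ffun I -> fps K}) (n : nat) :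
  (forall i, exists b, y i = fpsX ^+ n * b) ->
  (n%:R%:E <= valt R [ffun i => to_laurent (y i)])%E.
Proof.
move=> yP; apply: ereal_sup_ubound; exists n => //.
exact/in_lattice_fpsP.
Qed.

Lemma valt_fps (I : finType) (y : {ffun I -> fps K}) (i0 : I) : y i0 != 0 ->
  (forall i, exists b, y i = fpsX ^+ fps_ord (y i0) * b) ->
  valt R [ffun i => to_laurent (y i)] = (fps_ord (y i0))%:R%:E.
Proof.
move=> y0 yP; rewrite (@valt_max _ _ _ _ (fps_ord (y i0))) //.
  exact/in_lattice_fpsP.
by case=> // n /in_lattice_fpsP yn; rewrite lez_nat fps_ord_max.
Qed.

Lemma valt_fps_neq0 (I : finType) (y : {ffun I -> fps K}) (i : I) : y i != 0 ->
  exists n : nat, (forall j, exists b, y j = fpsX ^+ n * b) /\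
    valt R [ffun i => to_laurent (y i)] = n%:R%:E.
Proof.
move=> yi.
case: (arg_minnP (P := fun i => y i != 0) (fun i => fps_ord (y i)) yi).
move=> i0 y0 i0P; exists (fps_ord (y i0)).
have yP j : exists b, y j = fpsX ^+ fps_ord (y i0) * b.
  have [->|yj] := eqVneq (y j) 0; first by exists 0; rewrite mulr0.
  have [u _ {1}->] := fps_ordP yj.
  exists (fpsX ^+ (fps_ord (y j) - fps_ord (y i0)) * u).
  by rewrite mulrA -exprD subnKC // i0P.
by split=> //; exact: valt_fps.
Qed.

Lemma valt_scalar_fps (a : fps K) : a != 0 ->
  valt_scalar R (to_laurent a) = (fps_ord a)%:R%:E.
Proof.
move=> a0; pose y : {ffun unit -> fps K} := [ffun=> a].
have yE : y tt = a by rewrite ffunE.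
rewrite -[in RHS]yE -(valt_fps (y := y) (i0 := tt)) ?yE //.
  by congr valt; apply/ffunP => i; rewrite !ffunE.
move=> i; have [u _ aE] := fps_ordP a0; exists u.
by rewrite -aE ffunE.
Qed.

End Valuation.

(** * Subadditivity of the G-stable rank *)

(** The length bound for a sum of two lattices: orders of determinants are
    lengths over the standard lattice. *)
Lemma fps_common_right_multiple (K : fieldType) n (A B : 'M[fps K]_n) :
  \det A != 0 -> \det B != 0 ->
  exists PQ : 'M[fps K]_n * 'M[fps K]_n, [/\ A *m PQ.1 = B *m PQ.2,
    \det (A *m PQ.1) != 0 &
    (fps_ord (\det (A *m PQ.1)) <= fps_ord (\det A) + fps_ord (\det B))%N].
Proof.
move=> A0 B0; have [P [Q [PQ [h [u [uu e]]]]]] :=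
  common_right_multiple (@fps_dvd_total K) A B.
have u0 : u != 0 by apply: contraTneq uu => ->; rewrite unitr0.
have : \det (A *m P) * h != 0 by rewrite e !mulf_neq0.
rewrite mulf_eq0 negb_or => /andP[AP0 h0]; exists (P, Q); split=> //=.
rewrite -[leqRHS]addn0 -(fps_ord_unit uu) -!fps_ordM ?mulf_neq0 // -e.
by rewrite fps_ordM // leq_addr.
Qed.

Section StableRank.
Variables (R : realType) (K : fieldType) (d : nat) (V : 'I_d -> vectType K).
Variable alpha : 'I_d -> R.
Hypothesis alpha_gt0 : forall i, 0 < alpha i.
Implicit Types (g h : forall i, 'M[fps K]_(\dim {:V i})) (v w : tensor V).

Definition tensor_fps v : tensor_ext V (fps K) := [ffun j => fpsC (v j : K)].

(** The condition val_t(g v) >= n, for a natural number n, without passing to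
    K((t)). *)
Definition act_dvd n g v :=
  forall j, exists b, tensor_act g (tensor_fps v) j = fpsX ^+ n * b.

(** The numerator of mu_alpha for g with nonzero determinants, as a real
    number. *)
Definition weight g : R := \sum_i alpha i * (fps_ord (\det (g i)))%:R.

Lemma GL_fpsE n (g : 'M[fps K]_n) : GL_fps g <-> \det g != 0.
Proof. by rewrite /GL_fps /= unitmxE det_map_mx unitfE tofrac_eq0. Qed.

Lemma fps_actE g v :
  fps_act g v = [ffun j => to_laurent (tensor_act g (tensor_fps v) j)].
Proof.
rewrite -tensor_act_map /fps_act; congr tensor_act.
by apply/ffunP => j; rewrite !ffunE.
Qed.

Lemma weight_ge0 g : 0 <= weight g.
Proof. by apply: sumr_ge0 => i _; rewrite mulr_ge0 // ltW. Qed.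

Lemma mu_alphaE g v : (forall i, \det (g i) != 0) ->
  mu_alpha alpha g v = ((weight g)%:E / valt R (fps_act g v))%E.
Proof.
move=> g0; rewrite /mu_alpha; congr (_ / _)%E.
by rewrite /weight -sumEFin; apply: eq_bigr => i _; rewrite valt_scalar_fps.
Qed.

Lemma mu_alpha_ge0 g v : (forall i, \det (g i) != 0) ->
  (0 < valt R (fps_act g v))%E -> (0 <= mu_alpha alpha g v)%E.
Proof.
move=> g0 gv; rewrite mu_alphaE // mule_ge0 ?lee_fin ?weight_ge0 //.
by rewrite inve_ge0 ltW.
Qed.

Lemma rkG_ge0 v : (0 <= rkG alpha v)%E.
Proof.
apply/ereal_infP => _ [g [gG gv] <-]; apply: mu_alpha_ge0 => // i.
exact/GL_fpsE/gG.
Qed.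

Lemma rkG_le_mu g v : (forall i, \det (g i) != 0) ->
  (0 < valt R (fps_act g v))%E -> (rkG alpha v <= mu_alpha alpha g v)%E.
Proof.
move=> g0 gv; apply: ereal_inf_lbound; exists g => //; split; last exact: gv.
by move=> i; exact: (GL_fpsE (g i)).2.
Qed.

Lemma rkG_le g v n : (forall i, \det (g i) != 0) -> (0 < n)%N ->
  act_dvd n g v -> (rkG alpha v <= (weight g / n%:R)%:E)%E.
Proof.
move=> g0 n0 gv; have nv : (n%:R%:E <= valt R (fps_act g v))%E.
  by rewrite fps_actE; exact: valt_ge.
have n0' : (0 < n%:R%:E :> \bar R)%E by rewrite lte_fin ltr0n.
apply: le_trans (rkG_le_mu g0 (lt_le_trans n0' nv)) _.
rewrite mu_alphaE // EFinM lee_wpmul2l ?lee_fin ?weight_ge0 //.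
have -> : (n%:R^-1%:E = n%:R%:E^-1 :> \bar R)%E.
  by rewrite inver gt_eqF // ltr0n.
by rewrite lee_pV2 // inE ltW // (lt_le_trans n0').
Qed.

(** For v <> 0 the denominator of mu_alpha is finite, since g is injective on
    tensors; so the quotient is one of real numbers. *)
Lemma mu_alpha_neq0 g v : v != 0 -> (forall i, \det (g i) != 0) ->
  (0 < valt R (fps_act g v))%E ->
  exists n, [/\ (0 < n)%N, act_dvd n g v &
    mu_alpha alpha g v = (weight g / n%:R)%:E].
Proof.
move=> v0 g0; have [j vj] : exists j, (v j : K) != 0.
  apply/existsP; apply: contraNT v0 => /existsPn v0; apply/eqP/ffunP => j.
  by rewrite [RHS]ffunE; apply/eqP; rewrite -[_ == _]negbK v0.
have [k gk] : exists k, tensor_act g (tensor_fps v) k != 0.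
  apply: (tensor_act_neq0 (j := j)) => //; rewrite ffunE.
  by apply: contraNneq vj => /(congr1 (fun a => fcoef a 0)) /= ->.
have [n [gn vn]] := valt_fps_neq0 R gk.
rewrite mu_alphaE // fps_actE vn lte_fin ltr0n => n0; exists n; split=> //.
by rewrite inver gt_eqF ?ltr0n // EFinM.
Qed.

(** The substitution fixes v, whose coordinates are constant series. *)
Lemma act_dvd_subst k n g v : act_dvd n g v ->
  act_dvd (k.+1 * n) (fun i => map_mx (fps_subst k) (g i)) v.
Proof.
move=> gv j; have -> : tensor_fps v = [ffun j => fps_subst k (tensor_fps v j)].
  by apply/ffunP => l; rewrite !ffunE fps_substC.
by rewrite tensor_act_map ffunE; exact: fps_subst_dvd.
Qed.

Lemma act_dvd_mul n g h v : act_dvd n g v ->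
  act_dvd n (fun i => g i *m h i) v.
Proof. by move=> gv j; rewrite tensor_act_mul; exact: tensor_act_dvd. Qed.

Lemma act_dvdD n g v w : act_dvd n g v -> act_dvd n g w -> act_dvd n g (v + w).
Proof.
move=> gv gw j; have -> : tensor_fps (v + w) =
    [ffun k => tensor_fps v k + tensor_fps w k].
  apply/ffunP => k; rewrite !ffunE; apply: fpsP => -[|m] //=.
  by rewrite addr0.
rewrite tensor_actD; have [b ->] := gv j; have [c ->] := gw j.
by exists (b + c); rewrite mulrDr.
Qed.

Lemma weight_subst k g : (forall i, \det (g i) != 0) ->
  weight (fun i => map_mx (fps_subst k) (g i)) = k.+1%:R * weight g.
Proof.
move=> g0; rewrite /weight mulr_sumr; apply: eq_bigr => i _.
by rewrite det_map_mx fps_ord_subst // natrM mulrCA.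
Qed.

Lemma exists_common_multiple g h :
  (forall i, \det (g i) != 0) -> (forall i, \det (h i) != 0) ->
  exists p q, [/\ (fun i => g i *m p i) = (fun i => h i *m q i),
    forall i, \det (g i *m p i) != 0 &
    weight (fun i => g i *m p i) <= weight g + weight h].
Proof.
move=> g0 h0; have pqP i := cid (fps_common_right_multiple (g0 i) (h0 i)).
exists (fun i => (projT1 (pqP i)).1), (fun i => (projT1 (pqP i)).2); split.
- by apply: functional_extensionality_dep => i; case: (pqP i) => pq [].
- by move=> i; case: (pqP i) => pq [].
rewrite /weight -big_split; apply: ler_sum => i _ /=; rewrite -mulrDr -natrD.
by rewrite ler_pM2l // ler_nat; case: (pqP i) => pq [].
Qed.

(** Bring both divisibility exponents to m n by t -> t^n in g and t -> t^m in h,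
    then pass to the common right multiple. *)
Lemma rkG_add_le g h v w m n :
  (forall i, \det (g i) != 0) -> (forall i, \det (h i) != 0) ->
  (0 < m)%N -> (0 < n)%N -> act_dvd m g v -> act_dvd n h w ->
  (rkG alpha (v + w)%R <= (weight g / m%:R + weight h / n%:R)%:E)%E.
Proof.
case: m n => [//|m] [//|n] g0 h0 _ _ gv hw.
pose g' i := map_mx (fps_subst n) (g i).
pose h' i := map_mx (fps_subst m) (h i).
have g'0 i : \det (g' i) != 0 by rewrite det_map_mx fps_subst_neq0.
have h'0 i : \det (h' i) != 0 by rewrite det_map_mx fps_subst_neq0.
have [p [q [pq pq0 le_pq]]] := exists_common_multiple g'0 h'0.
have vwP : act_dvd (n.+1 * m.+1) (fun i => g' i *m p i) (v + w).
  apply: act_dvdD; first exact/act_dvd_mul/act_dvd_subst.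
  by rewrite pq mulnC; exact/act_dvd_mul/act_dvd_subst.
apply: le_trans (rkG_le pq0 _ vwP) _ => //.
rewrite lee_fin ler_pdivrMr ?ltr0n // (le_trans le_pq) //.
rewrite !weight_subst // natrM mulrDl lerD //.
  by rewrite mulrCA divfK ?pnatr_eq0 // mulrC.
by rewrite [n.+1%:R * _]mulrC mulrCA divfK ?pnatr_eq0 // mulrC.
Qed.

(** A zero tensor has to be treated apart: its valuation is infinite, and there
    is then no common finite exponent to aim at. *)
Lemma rkG_add_le_mu g h v w :
  (forall i, \det (g i) != 0) -> (0 < valt R (fps_act g v))%E ->
  (forall i, \det (h i) != 0) -> (0 < valt R (fps_act h w))%E ->
  (rkG alpha (v + w)%R <= mu_alpha alpha g v + mu_alpha alpha h w)%E.
Proof.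
move=> g0 gv h0 hw.
have [v0|v0] := eqVneq v 0.
  rewrite v0 in gv *.
  rewrite add0r (@le_trans _ _ (mu_alpha alpha h w)) //; last first.
    by rewrite leeDr // mu_alpha_ge0.
  exact: (rkG_le_mu h0 hw).
have [w0|w0] := eqVneq w 0.
  rewrite w0 in hw *.
  rewrite addr0 (@le_trans _ _ (mu_alpha alpha g v)) //; last first.
    by rewrite leeDl // mu_alpha_ge0.
  exact: (rkG_le_mu g0 gv).
have [m [m0 gm ->]] := mu_alpha_neq0 v0 g0 gv.
have [n [n0 hn ->]] := mu_alpha_neq0 w0 h0 hw.
by rewrite -EFinD; exact: rkG_add_le.
Qed.

End StableRank.

Theorem proposition3p6 (R : realType) (K : fieldType) (hK : perfect_field K)
    (d : nat) (V : 'I_d -> vectType K)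
    (alpha : 'I_d -> R) (halpha : forall i : 'I_d, 0 < alpha i)
    (v w : tensor V) :
  (rkG alpha (v + w)%R <= rkG alpha v + rkG alpha w)%E.
Proof.
have rkNy (u : tensor V) : rkG alpha u != -oo%E.
  by rewrite -ltNye (lt_le_trans (ltNyr 0)) // rkG_ge0.
have [->|vy] := eqVneq (rkG alpha v) +oo%E; first by rewrite addye ?leey.
have [->|wy] := eqVneq (rkG alpha w) +oo%E; first by rewrite addey ?leey.
have fin (u : tensor V) : rkG alpha u != +oo%E -> rkG alpha u \is a fin_num.
  by rewrite fin_numE rkNy.
apply/lee_addgt0Pr => e e0; have e20 : 0 < e / 2 by rewrite divr_gt0.
have [_ [g [gG gv] <-] /ltW ge] := lb_ereal_inf_adherent e20 (fin v vy).
have [_ [h [hG hw] <-] /ltW he] := lb_ereal_inf_adherent e20 (fin w wy).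
apply: (@le_trans _ _ (mu_alpha alpha g v + mu_alpha alpha h w)%E).
  apply: rkG_add_le_mu; [exact: halpha | | exact: gv | | exact: hw] => i.
    exact: (GL_fpsE (g i)).1.
  exact: (GL_fpsE (h i)).1.
apply: le_trans (leeD ge he) _.
by rewrite addeACA -EFinD -splitr.
Qed.
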